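(* Let $\mathcal{M}$ be a finite MDP, $\varphi$ an scLTL formula over $\mathcal{AP}$, and $\overline{\epsilon}>0$. If the agent's decision horizon is $N=1$, then there exists an $\overline{\epsilon}$-optimal incentive design on $\mathcal{M}$.
   Context: MDP. $\mathcal{M}=(S,s_0,\mathcal{A},\mathcal{P},\mathcal{AP},\mathcal{L},\mathcal{R})$ with finite state set $S$, initial state $s_0$, finite action set $\mathcal{A}$, nonempty sets $\mathcal{A}(s)\subseteq\mathcal{A}$ of available actions, transition probabilities $\mathcal{P}_{s,a,s'}$ with $\sum_{s'}\mathcal{P}_{s,a,s'}=1$ for $a\in\mathcal{A}(s)$, finite set $\mathcal{AP}$ of atomic propositions, labeling $\mathcal{L}:S\to2^{\mathcal{AP}}$, reward $\mathcal{R}:S\times\mathcal{A}\to\mathbb{R}$. A decision rule assigns to each state a probability distribution over its available actions; an $N$-stage policy is a sequence of $N$ decision rules, and $\Pi_N(\mathcal{M})$ denotes the set of these. scLTL. A syntactically co-safe linear temporal logic (scLTL) formula $\varphi$ is interpreted over infinite words on $2^{\mathcal{AP}}$; there is a deterministic finite automaton over the alphabet $2^{\mathcal{AP}}$ such that an infinite word satisfies $\varphi$ iff some finite prefix of it is accepted. A path $s_0s_1\ldots$ of $\mathcal{M}$ satisfies $\varphi$ if the word $\mathcal{L}(s_0)\mathcal{L}(s_1)\ldots$ does. Agent and incentive designs (general decision horizon $N$). Stages $t=1,2,\ldots$ are grouped in planning periods $k=0,1,2,\ldots$, the $k$-th consisting of stages $kN+1,\ldots,kN+N$. At the start of period $k$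 the principal, who has observed the path so far, offers functions $\gamma_{kN+1},\ldots,\gamma_{kN+N}:S\times\mathcal{A}\to\mathbb{R}_{\ge0}$. The rule $\Gamma$ prescribing these offers is an incentive design on $\mathcal{M}$. The agent then computes and implements for $N$ stages an $N$-stage policy $\pi^\star_k\in\Pi_N(\mathcal{M})$ that maximizes, simultaneously for every starting state $s\in S$, $\mathbb{E}^{\pi}_s\big[\sum_{t=1}^N(\mathcal{R}(S_t,A_t)+\gamma_{kN+t}(S_t,A_t))\big]$. An optimal policy of the agent under $\Gamma$ is any resulting overall behavior $\pi^\star=(\pi_0^\star,\pi_1^\star,\ldots)$. The incentive $\gamma_t(s,a)$ is paid only if action $a$ is taken in $s$ at stage $t$, so the cost of $\Gamma$ is $\mathbb{E}^{\pi^\star}_{s_0}\big[\sum_{t=1}^\infty\gamma_t(S_t,A_t)\big]$. $\overline\epsilon$-optimality. $\Gamma$ is feasible if the agent's optimal policy under $\Gamma$ satisfies $\varphi$ with the maximum probability achievable by any (history-dependent) policy from $s_0$. If the agent has several optimal policies, feasibility is required for all of them and the cost is the supremum over them. For $\overline\epsilon>0$, a design is $\overline{\epsilon}$-optimal if it is feasible and its cost is at most $\overline\epsilon$ plus the infimum of the costs of all feasible designs on $\mathcal{M}$. *)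

(* Defs.v *)
From HB Require Import structures.
From mathcomp Require Import all_boot all_order all_algebra.
From mathcomp Require Import all_classical all_reals all_analysis.

Set Implicit Arguments.
Unset Strict Implicit.
Unset Printing Implicit Defensive.

Import Order.TTheory GRing.Theory Num.Theory.

Local Open Scope classical_set_scope.
Local Open Scope ring_scope.

(* The parameter [x0] only serves to make the space of sequences pointed. *)
Definition infseq (T : finType) (x0 : T) : Type := nat -> T.

Section InfSeq.
Context (T : finType) (x0 : T).

HB.instance Definition _ := Choice.copy (infseq x0) (nat -> T).
HB.instance Definition _ := isPointed.Build (infseq x0) (fun=> x0).

Definition determined (n : nat) (A : set (infseq x0)) :=
  forall u v : infseq x0, (forall i, (i < n)%N -> u i = v i) -> A u -> A v.

Definition finitary (A : set (infseq x0)) := exists n, determined n A.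

Lemma determined_le m n A : (m <= n)%N -> determined m A -> determined n A.
Proof.
move=> mn dA u v uv; apply: dA => i im; apply: uv; exact: leq_trans mn.
Qed.

Lemma finitary0 : finitary set0. Proof. by exists 0%N. Qed.

Lemma determinedU n A B :
  determined n A -> determined n B -> determined n (A `|` B).
Proof.
by move=> dA dB u v uv [Au|Bu]; [left; exact: dA Au|right; exact: dB Bu].
Qed.

Lemma finitaryU : setU_closed finitary.
Proof.
move=> A B [m dA] [n dB]; exists (maxn m n); apply: determinedU.
  exact: determined_le (leq_maxl _ _) dA.
exact: determined_le (leq_maxr _ _) dB.
Qed.

Lemma finitaryC : setC_closed finitary.
Proof.
move=> A [n dA]; exists n => u v uv nAu Av; apply: nAu.
by apply: dA Av => i im; rewrite uv.
Qed.

HB.instance Definition _ := isAlgebraOfSets.Build default_measure_display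
  (infseq x0) finitary0 finitaryU finitaryC.

Lemma finitary_measurable (A : set (infseq x0)) : finitary A -> measurable A.
Proof. by []. Qed.

Lemma measurable_finitary (A : set (infseq x0)) : measurable A -> finitary A.
Proof. by []. Qed.

Definition cyl (w : seq T) : set (infseq x0) :=
  [set u | forall i, (i < size w)%N -> u i = nth x0 w i].

Lemma determined_cyl w : determined (size w) (cyl w).
Proof. by move=> u v uv cu i iw; rewrite -uv// cu. Qed.

End InfSeq.

Arguments cyl {T} x0 w.

Record cyl_weights (R : realType) (T : finType) := CylWeights {
  weight :> seq T -> R ;
  weight_ge0 : forall w, 0 <= weight w ;
  weight_nil : weight [::] = 1 ;
  weight_rcons : forall w, \sum_x weight (rcons w x) = weight w }.

Section Mass.
Context (R : realType) (T : finType) (x0 : T) (p : cyl_weights R T).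
Implicit Types A B : set (infseq x0).

(* The total weight of the extensions of [w] by [n] letters that lie in [A]. *)
Fixpoint mass (n : nat) (w : seq T) (A : set (infseq x0)) : R :=
  if n is m.+1 then \sum_x mass m (rcons w x) A
  else if `[< A (nth x0 w) >] then p w else 0.

Lemma mass_ge0 n w A : 0 <= mass n w A.
Proof.
elim: n w => [|n IH] w /=; last by apply: sumr_ge0 => x _; exact: IH.
by case: ifP => // _; exact: weight_ge0.
Qed.

Lemma mass_determined n w A : determined (size w) A ->
  mass n w A = mass 0 w A.
Proof.
elim: n w => [|n IH] w dA //=.
have AE x : `[< A (nth x0 (rcons w x)) >] = `[< A (nth x0 w) >].
  by apply: asbool_equiv_eq; split; apply: dA => i iw; rewrite nth_rcons iw.
under eq_bigr => x _.
  rewrite IH /= ?AE; first over.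
  by apply: determined_le dA; rewrite size_rcons.
by case: ifP => _; [exact: weight_rcons|rewrite big1].
Qed.

Lemma massD m n w A : determined (size w + n) A ->
  mass (n + m) w A = mass n w A.
Proof.
elim: n w => [|n IH] w dA; first by apply: mass_determined; rewrite addn0 in dA.
by rewrite addSn /=; apply: eq_bigr => x _; apply: IH; rewrite size_rcons addSnnS.
Qed.

Lemma massU n w A B : A `&` B = set0 ->
  mass n w (A `|` B) = mass n w A + mass n w B.
Proof.
move=> AB; elim: n w => [|n IH] w /=; last first.
  by rewrite -big_split; apply: eq_bigr => x _; exact: IH.
rewrite asbool_or; case: asboolP => Aw; case: asboolP => Bw /=; last 3 first.
- by rewrite addr0.
- by rewrite add0r.
- by rewrite addr0.
by have : (A `&` B) (nth x0 w) by []; rewrite AB.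
Qed.

Lemma mass_empty n w A : (forall u, cyl x0 w u -> ~ A u) -> mass n w A = 0.
Proof.
elim: n w => [|n IH] w wA /=.
  by case: asboolP => // Aw; case: (wA (nth x0 w)).
apply: big1 => x _; apply: IH => u cu; apply: wA => i iw.
by rewrite cu ?size_rcons ?nth_rcons ?iw// ltnW.
Qed.

Lemma mass_cyl u v : mass (size v) u (cyl x0 (u ++ v)) = p (u ++ v).
Proof.
elim: v u => [|y v IH] u.
  by rewrite cats0 /=; case: asboolP => // -[].
rewrite /= (bigD1 y)//= -cat_rcons IH big1 ?addr0// => x xy.
apply: mass_empty => s cs ct.
have i1 : (size u < size (rcons u x))%N by rewrite size_rcons.
have i2 : (size u < size (rcons u y ++ v))%N.
  by rewrite size_cat size_rcons addSn ltnS leq_addr.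
have := cs _ i1; rewrite (ct _ i2) nth_rcons ltnn eqxx nth_cat size_rcons ltnSn.
by rewrite nth_rcons ltnn eqxx => /esym/eqP; rewrite (negbTE xy).
Qed.

(* A finitary set is determined by its first [level] letters. *)
Definition level A : nat := xget 0%N [set n | determined n A].

Lemma levelP A : finitary A -> determined (level A) A.
Proof. by move=> [n dn]; rewrite /level; case: xgetP => [m -> //|/(_ n)]. Qed.

Definition cyl_content (A : set (infseq x0)) : \bar R :=
  (mass (level A) [::] A)%:E.

Lemma cyl_contentE n A : determined n A -> cyl_content A = (mass n [::] A)%:E.
Proof.
move=> dn; have dl : determined (level A) A by apply: levelP; exists n.
rewrite /cyl_content; congr EFin.
case: (leqP n (level A)) => [nl|/ltnW ln].
  by rewrite -(subnKC nl) massD.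
by rewrite -(subnKC ln) massD.
Qed.

Lemma cyl_content_ge0 A : (0 <= cyl_content A)%E.
Proof. by rewrite lee_fin mass_ge0. Qed.

Lemma cyl_content0 : cyl_content set0 = 0%E.
Proof. by rewrite (@cyl_contentE 0)//= asboolF. Qed.

Lemma cyl_content_cyl w : cyl_content (cyl x0 w) = (p w)%:E.
Proof. by rewrite (cyl_contentE (@determined_cyl _ _ w)) -(mass_cyl [::] w). Qed.

Lemma cyl_content_setT : cyl_content setT = 1%E.
Proof. by rewrite (@cyl_contentE 0)//= asboolT// weight_nil. Qed.

Lemma cyl_content_additive : measure_function.semi_additive cyl_content.
Proof.
apply/(additive2P cyl_content0) => A B [m dA] [n dB] AB.
have {}dA := determined_le (leq_maxl m n) dA.
have {}dB := determined_le (leq_maxr m n) dB.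
rewrite (cyl_contentE dA) (cyl_contentE dB) (cyl_contentE (determinedU dA dB)).
by rewrite massU.
Qed.

HB.instance Definition _ := isContent.Build _ (infseq x0) R cyl_content
  cyl_content_ge0 cyl_content_additive.

Lemma finitary_compact A (F : nat -> set (infseq x0)) :
  finitary A -> (forall i, finitary (F i)) -> A `<=` \bigcup_i F i ->
  exists n, A `<=` \big[setU/set0]_(i < n) F i.
Proof.
move=> [l dA] fF AF.
pose good w := exists n, A `&` cyl x0 w `<=` \big[setU/set0]_(i < n) F i.
have [[n An]|bad0] := pselect (good [::]); first by exists n => u Au; apply: An.
have step w : ~ good w -> exists x, ~ good (rcons w x).
  move=> bw; apply/existsNP => gw; apply: bw.
  have {gw}[f fP] := choice gw.
  exists (\max_x f x)%N => u [Au cu].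
  have : (A `&` cyl x0 (rcons w (u (size w)))) u.
    split=> // i; rewrite size_rcons ltnS leq_eqVlt nth_rcons.
    by case/orP => [/eqP ->|iw]; rewrite ?ltnn ?eqxx// iw cu.
  move=> /fP; apply: subset_bigsetU; exact: leq_bigmax.
pose next w := xget x0 [set x | ~ good (rcons w x)].
pose pre := fix pre n := if n is m.+1 then rcons (pre m) (next (pre m)) else [::].
have sz n : size (pre n) = n by elim: n => //= n IH; rewrite size_rcons IH.
have bad n : ~ good (pre n).
  elim: n => //= n /step[x bx]; rewrite /next.
  by case: xgetP => [y _ //|/(_ x)/(_ bx)].
pose u : infseq x0 := fun i => next (pre i).
have nth_pre n i : (i < n)%N -> nth x0 (pre n) i = u i.
  elim: n => //= n IH; rewrite ltnS leq_eqVlt nth_rcons sz => /orP[/eqP ->|lt].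
    by rewrite ltnn eqxx.
  by rewrite lt IH.
have cylu n v : cyl x0 (pre n) v -> forall i, (i < n)%N -> v i = u i.
  by move=> cv i lt; rewrite cv ?sz// nth_pre.
have Au : A u.
  apply: contrapT => nAu; apply: (bad l); exists 0%N => v [Av cv].
  by case: nAu; apply: dA Av => i /(cylu _ _ cv).
have [i _ Fu] := AF _ Au; have [n dF] := fF i.
case: (bad n); exists i.+1 => v [_ cv].
rewrite big_ord_recr /=; right; apply: dF Fu => j jn.
by rewrite (cylu _ _ cv).
Qed.

Lemma cyl_content_sigma_subadditive :
  measurable_subset_sigma_subadditive cyl_content.
Proof.
move=> A F mF mA AF; have [n An] := finitary_compact mA mF AF.
apply: (le_trans (content_subadditive cyl_content (fun k _ => mF k) mA An)).
by rewrite -(big_mkord xpredT (cyl_content \o F)); exact: nneseries_lim_ge.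
Qed.

HB.instance Definition _ := Content_SigmaSubAdditive_isMeasure.Build _ R
  (infseq x0) cyl_content cyl_content_sigma_subadditive.

Definition cyl_measure := measure_extension cyl_content.

HB.instance Definition _ := Measure.on cyl_measure.

Lemma cyl_measureE A : finitary A -> cyl_measure A = cyl_content A.
Proof.
by move=> /finitary_measurable mA; rewrite /cyl_measure /measure_extension
  measurable_mu_extE.
Qed.

Lemma cyl_measure_cyl w : cyl_measure (cyl x0 w) = (p w)%:E.
Proof.
rewrite cyl_measureE ?cyl_content_cyl//; exists (size w); exact: determined_cyl.
Qed.

Lemma cyl_measure_setT : cyl_measure setT = 1%E.
Proof. by rewrite cyl_measureE ?cyl_content_setT//; exists 0%N. Qed.

HB.instance Definition _ := Measure_isProbability.Build _ _ R cyl_measure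
  cyl_measure_setT.

End Mass.

Arguments cyl_measure {R T} x0 p.

Inductive scltl (AP : finType) : Type :=
| LTrue
| LAtom of AP
| LNotAtom of AP
| LAnd of scltl AP & scltl AP
| LOr of scltl AP & scltl AP
| LNext of scltl AP
| LUntil of scltl AP & scltl AP.

(* "Eventually phi" is [LUntil (LTrue _) phi]. *)
Fixpoint satisfies (AP : finType) (w : nat -> {set AP}) (phi : scltl AP) :
    Prop :=
  match phi with
  | LTrue => True
  | LAtom p => p \in w 0%N
  | LNotAtom p => p \notin w 0%N
  | LAnd phi1 phi2 => satisfies w phi1 /\ satisfies w phi2
  | LOr phi1 phi2 => satisfies w phi1 \/ satisfies w phi2
  | LNext phi1 => satisfies (fun i => w i.+1) phi1
  | LUntil phi1 phi2 => exists k : nat,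
      satisfies (fun i => w (k + i)%N) phi2 /\
      forall j, (j < k)%N -> satisfies (fun i => w (j + i)%N) phi1
  end.

Record mdp (R : realType) := MDP {
  state : finType ;
  init : state ;
  action : finType ;
  avail : state -> {set action} ;
  avail_ex : forall s, exists a, a \in avail s ;
  trans : state -> action -> state -> R ;
  trans_ge0 : forall s a s', a \in avail s -> 0 <= trans s a s' ;
  trans_sum : forall s a, a \in avail s -> \sum_s' trans s a s' = 1 ;
  ap : finType ;
  label : state -> {set ap} ;
  reward : state -> action -> R }.

Record decision_rule (R : realType) (M : mdp R) := DecisionRule {
  rule :> state M -> action M -> R ;
  rule_ge0 : forall s a, 0 <= rule s a ;
  rule_sum : forall s, \sum_a rule s a = 1 ;
  rule_avail : forall s a, a \notin avail s -> rule s a = 0 }.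

(* The past of a run: the state-action pairs of the stages already played. *)
Definition history (R : realType) (M : mdp R) := seq (state M * action M).

Definition policy (R : realType) (M : mdp R) := history M -> decision_rule M.

Definition stage_policy (R : realType) (M : mdp R) (N : nat) :=
  'I_N -> decision_rule M.

Section PathLaw.
Context (R : realType) (M : mdp R).
Notation S := (state M).
Notation A := (action M).

(* The probability that a run whose first state is drawn from [mu] and whose
   actions are drawn from [pi] starts with the state-action pairs [w]. *)
Fixpoint run_prob (mu : S -> R) (pi : history M -> S -> A -> R)
    (w : history M) : R :=
  if w is (s, a) :: w' then
    mu s * pi [::] s a * run_prob (trans s a) (fun h => pi ((s, a) :: h)) w'
  else 1.

Definition start (s : S) : S -> R := fun s' => (s' == s)%:R.

Let is_dist (mu : S -> R) := (forall s, 0 <= mu s) /\ \sum_s mu s = 1.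

Let is_dist_start s : is_dist (start s).
Proof.
split=> [s'|]; first exact: ler0n.
rewrite (bigD1 s)//= big1 ?addr0 /start ?eqxx// => s' /negPf ->//.
Qed.

Let is_dist_trans s a : a \in avail s -> is_dist (trans s a).
Proof. by move=> sa; split=> [s'|]; [exact: trans_ge0|exact: trans_sum]. Qed.

Let run_prob_ge0 (mu : S -> R) (pi : policy M) w : is_dist mu ->
  0 <= run_prob mu (fun h => pi h) w.
Proof.
elim: w mu pi => [|[s a] w IH] mu pi dmu; first exact: ler01.
rewrite /=; have [sa|sa] := boolP (a \in avail s); last first.
  by rewrite rule_avail// mulr0 mul0r.
rewrite !mulr_ge0 ?(proj1 dmu) ?rule_ge0//.
exact: (IH _ (fun h => pi ((s, a) :: h)) (is_dist_trans sa)).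
Qed.

Let run_prob_rcons (mu : S -> R) (pi : policy M) w : is_dist mu ->
  \sum_x run_prob mu (fun h => pi h) (rcons w x) = run_prob mu (fun h => pi h) w.
Proof.
elim: w mu pi => [|[s a] w IH] mu pi dmu.
  transitivity (\sum_s mu s); last exact: (proj2 dmu).
  under [RHS]eq_bigr => s _ do
    rewrite -[mu s]mulr1 -(rule_sum (pi [::]) s) mulr_sumr.
  by rewrite pair_bigA /=; apply: eq_bigr => -[s a] _ /=; rewrite mulr1.
rewrite /= -mulr_sumr; have [sa|sa] := boolP (a \in avail s); last first.
  by rewrite rule_avail// mulr0 !mul0r.
by congr (_ * _); exact: (IH _ (fun h => pi ((s, a) :: h)) (is_dist_trans sa)).
Qed.

Definition run_weights (s : S) (pi : policy M) : cyl_weights R (S * A)%type :=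
  CylWeights (fun w => run_prob_ge0 pi w (is_dist_start s)) erefl
             (fun w => run_prob_rcons pi w (is_dist_start s)).

Definition default_pair : S * A := (init M, xchoose (avail_ex (init M))).

(* The law of the infinite run [S_1, A_1, S_2, A_2, ...] from [s] under [pi];
   stage [t] is the index [t - 1]. *)
Definition path_law (s : S) (pi : policy M) :=
  cyl_measure default_pair (run_weights s pi).

Lemma path_law_cyl s pi (w : history M) :
  path_law s pi (cyl default_pair w) = (run_prob (start s) pi w)%:E.
Proof. exact: cyl_measure_cyl. Qed.

HB.instance Definition _ s pi := Probability.copy (path_law s pi)
  (cyl_measure default_pair (run_weights s pi)).

Definition path_satisfies (phi : scltl (ap M)) (u : nat -> S * A) : Prop :=
  satisfies (fun t => label (u t).1) phi.

Definition sat_prob (phi : scltl (ap M)) (pi : policy M) : \bar R :=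
  path_law (init M) pi [set u | path_satisfies phi u].

End PathLaw.

Section Incentives.
Context (R : realType) (M : mdp R) (N : nat).
Notation S := (state M).
Notation A := (action M).

Definition offers := 'I_N -> S -> A -> {nonneg R}.

(* [G p] are the offers made at the start of a planning period when the states
   observed so far, the current one included, are [p]. *)
Definition design := seq S -> offers.

(* Only histories of length less than [N] matter for the first [N] stages. *)
Definition play (rho : stage_policy M N) (h : history M) (s : S) (a : A) : R :=
  if insub (size h) is Some j then rho j s a else 0.

Definition stage_value (g : offers) (rho : stage_policy M N) (s : S) : R :=
  \sum_(w : N.-tuple (S * A)) run_prob (start s) (play rho) w *
    \sum_(j < N) (reward (tnth w j).1 (tnth w j).2 +
                  (g j (tnth w j).1 (tnth w j).2)%:num).

Definition stage_optimal (g : offers) (rho : stage_policy M N) : Prop :=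
  forall (rho' : stage_policy M N) (s : S),
    stage_value g rho' s <= stage_value g rho s.

(* At each start of a period, with past [h] and current state [s], the agent
   picks an optimal [rho] and implements it: [h'] is the part of the past that
   belongs to the current period. *)
Definition agent_optimal (G : design) (pi : policy M) : Prop :=
  forall (k : nat) (h : history M) (s : S), size h = (k * N)%N ->
  exists2 rho : stage_policy M N,
    stage_optimal (G (rcons (unzip1 h) s)) rho &
    forall (j : 'I_N) (h' : history M) (s' : S),
      size h' = j -> head s' (unzip1 h') = s ->
      forall a, pi (h ++ h') s' a = rho j s' a.

(* The sum over all stages is grouped by planning periods [k]. *)
Definition payments (G : design) (u : nat -> S * A) : \bar R :=
  (\sum_(k <oo) \sum_(j < N)
    (G [seq (u i).1 | i <- iota 0 (k * N).+1] j
       (u (k * N + j)%N).1 (u (k * N + j)%N).2)%:num%:E)%E.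

Definition expected_cost (G : design) (pi : policy M) : \bar R :=
  (\int[path_law (init M) pi]_u payments G u)%E.

Definition cost (G : design) : \bar R :=
  ereal_sup [set expected_cost G pi | pi in [set pi | agent_optimal G pi]].

Definition feasible (phi : scltl (ap M)) (G : design) : Prop :=
  forall pi, agent_optimal G pi ->
  forall pi' : policy M, (sat_prob phi pi' <= sat_prob phi pi)%E.

Definition eps_optimal (phi : scltl (ap M)) (eps : R) (G : design) : Prop :=
  feasible phi G /\
  (cost G <= ereal_inf [set cost G' | G' in [set G' | feasible phi G']]
             + eps%:E)%E.

End Incentives.

(* Main.v *)
Require Import Defs.
From mathcomp Require Import all_boot all_order all_algebra lra.
From mathcomp Require Import all_classical all_reals all_analysis.

(* Near-optimality is immediate from the definition of the infimum, so the
   content is the existence of one feasible design. An scLTL formula has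
   finitely many residual languages and is decided by a finite prefix, so its
   satisfaction is reachability of an absorbing set [F] by a finite automaton
   reading the states. Some deterministic policy that remembers only the
   automaton state maximizes the probability of reaching [F] among all
   history-dependent randomized policies: there are finitely many of them, and
   for every horizon [n] and discount [l < 1] the greedy policy of the [n]-step
   discounted problem reaches [F] with probability at least [l ^+ n] times that
   of any policy within [n] stages; then let [l] tend to [1]. With decision
   horizon 1 the agent is myopic, and a bonus exceeding all reward differences,
   offered for the action this policy prescribes after the observed states,
   makes it the agent's only optimal policy. *)

Set Implicit Arguments.
Unset Strict Implicit.
Unset Printing Implicit Defensive.

Import Order.TTheory GRing.Theory Num.Theory.
Import numFieldNormedType.Exports.

Local Open Scope classical_set_scope.
Local Open Scope ring_scope.

(** * From scLTL formulas to absorbing reachability in a finite automaton *)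

Section CoSafety.
Context (AP : finType).
Implicit Types (phi : scltl AP) (w : nat -> {set AP}).

Lemma satisfies_until phi1 phi2 w :
  satisfies w (LUntil phi1 phi2) <->
  satisfies w phi2 \/
  satisfies w phi1 /\ satisfies (fun i => w i.+1) (LUntil phi1 phi2).
Proof.
split=> [[[|k] [w2 w1]]|[w2|[w1 [k [w2 w1']]]]].
- by left.
- by right; split; [exact: (w1 0%N)|exists k; split=> // j; exact: (w1 j.+1)].
- by exists 0%N.
- by exists k.+1; split=> // -[//|j]; exact: (w1' j).
Qed.

(** Negation occurs only on atoms, so finitely many letters witness satisfaction; for until, an
    inner induction on the witness [k] uses the expansion law. *)
Lemma satisfies_prefix phi w : satisfies w phi ->
  exists n, forall w', (forall i, (i < n)%N -> w' i = w i) -> satisfies w' phi.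
Proof.
elim: phi w => [|p|p|p IHp q IHq|p IHp q IHq|p IHp|p IHp q IHq] w /=.
- by exists 0%N.
- by move=> wp; exists 1%N => w' ->.
- by move=> wp; exists 1%N => w' ->.
- move=> [/IHp[m mP] /IHq[n nP]]; exists (maxn m n) => w' ww'.
  by split; [apply: mP|apply: nP] => i lt_i; apply: ww';
    rewrite leq_max lt_i ?orbT.
- by move=> [/IHp|/IHq] [n nP]; exists n => w' /nP; [left|right].
- move=> /IHp[n nP]; exists n.+1 => w' ww'.
  by apply: nP => i; exact: (ww' i.+1).
- move=> [k [wk wj]]; elim: k w wk wj => [|k IHk] w wk wj.
    by have [n nP] := IHq _ wk; exists n => w' /nP ?; exists 0%N.
  have [m mP] := IHp _ (wj 0%N isT).
  have [n nP] := IHk (fun i => w i.+1) wk (fun j => wj j.+1).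
  exists (maxn m n.+1) => w' ww'; apply/satisfies_until; right; split.
    by apply: mP => i im; rewrite ww'// leq_max im.
  by apply: nP => i ii; rewrite ww'// leq_max [X in _ || X]ii orbT.
Qed.

(* For [LUntil p q] a state is a disjunction of conjunctions [(Y, z)] of
   residuals of [p], one per state of [Y], with either a residual of [q] or, if
   [z = None], the formula itself. *)
Lemma scltl_residuals phi :
  exists (Q : finType) (q0 : Q) (delta : Q -> {set AP} -> Q)
         (L : Q -> (nat -> {set AP}) -> Prop),
    (forall w, L q0 w <-> satisfies w phi) /\
    (forall q w, L q w <-> L (delta q (w 0%N)) (fun i => w i.+1)).
Proof.
elim: phi => [|p|p|p [Q1 [q1 [d1 [L1 [i1 s1]]]]] q [Q2 [q2 [d2 [L2 [i2 s2]]]]]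
                  |p [Q1 [q1 [d1 [L1 [i1 s1]]]]] q [Q2 [q2 [d2 [L2 [i2 s2]]]]]
                  |p [Q1 [q1 [d1 [L1 [i1 s1]]]]]
                  |p [Q1 [q1 [d1 [L1 [i1 s1]]]]] q [Q2 [q2 [d2 [L2 [i2 s2]]]]]].
- by exists unit, tt, (fun _ _ => tt), (fun _ _ => True).
(* [None] means that no letter has been read yet; afterwards the verdict on the first letter is
   stored. *)
- exists (option bool), None,
    (fun x (A : {set AP}) => Some (if x is Some b then b else p \in A)),
    (fun x (w : nat -> {set AP}) => if x is Some b then b else p \in w 0%N).
  by split=> // -[].
- exists (option bool), None,
    (fun x (A : {set AP}) => Some (if x is Some b then b else p \notin A)),
    (fun x (w : nat -> {set AP}) => if x is Some b then b else p \notin w 0%N).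
  by split=> // -[].
- exists (Q1 * Q2)%type, (q1, q2),
    (fun x (A : {set AP}) => (d1 x.1 A, d2 x.2 A)),
    (fun x w => L1 x.1 w /\ L2 x.2 w).
  split=> [w|x w] /=; first by rewrite i1 i2.
  by rewrite (s1 x.1) (s2 x.2).
- exists (Q1 * Q2)%type, (q1, q2),
    (fun x (A : {set AP}) => (d1 x.1 A, d2 x.2 A)),
    (fun x w => L1 x.1 w \/ L2 x.2 w).
  split=> [w|x w] /=; first by rewrite i1 i2.
  by rewrite (s1 x.1) (s2 x.2).
- exists (option Q1), None,
    (fun x (A : {set AP}) => Some (if x is Some y then d1 y A else q1)),
    (fun x (w : nat -> {set AP}) =>
      if x is Some y then L1 y w else L1 q1 (fun i => w i.+1)).
  by split=> [w|[y|] w] //=; rewrite ?i1.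
- pose T := ({set Q1} * option Q2)%type.
  pose holds (Z : T) w := (forall y, y \in Z.1 -> L1 y w) /\
    if Z.2 is Some z then L2 z w else satisfies w (LUntil p q).
  (* A pending until branches by its expansion law: either [q] starts at this letter, or [p] starts
     here and the until stays pending. *)
  pose step (A : {set AP}) (Z : T) : {set T} :=
    let Y := [set d1 y A | y in Z.1]%SET in
    if Z.2 is Some z then [set (Y, Some (d2 z A))]%SET
    else [set (Y, Some (d2 q2 A)); (d1 q1 A |: Y, None)]%SET.
  have imageP (Y : {set Q1}) (w : nat -> {set AP}) :
      (forall y, y \in Y -> L1 y w) <->
      forall y, y \in [set d1 y (w 0%N) | y in Y]%SET -> L1 y (fun i => w i.+1).
    split=> H y; last by move=> yY; apply/s1/H/imsetP; exists y.
    by move=> /imsetP[x /H/s1 ? ->].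
  have stepP Z w : holds Z w <->
      exists2 Z', Z' \in step (w 0%N) Z & holds Z' (fun i => w i.+1).
    case: Z => Y [z|] /=.
      split=> [[/(imageP Y w).1 HY /s2 Hz]|[Z']].
        by exists ([set d1 y (w 0%N) | y in Y]%SET, Some (d2 z (w 0%N)));
          [rewrite inE|].
      by rewrite inE => /eqP -> [/(imageP Y w).2 HY /(s2 z w).2 Hz].
    split=> [[/(imageP Y w).1 HY]|[Z']].
    - move=> /satisfies_until[/i2/s2 Hq|[/i1/s1 Hp HU]].
      + by exists ([set d1 y (w 0%N) | y in Y]%SET, Some (d2 q2 (w 0%N)));
          [rewrite !inE eqxx|].
      + exists (d1 q1 (w 0%N) |: [set d1 y (w 0%N) | y in Y]%SET, None)%SET;
          first by rewrite !inE eqxx orbT.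
        by split=> //= y /setU1P[->|/HY].
    - rewrite !inE => /orP[] /eqP -> [HY HZ]; split=> /=.
      + exact/(imageP Y w).
      + by apply/satisfies_until; left; apply/i2/s2.
      + by apply/(imageP Y w) => y yY; apply: HY; rewrite in_setU1 yY orbT.
      + apply/satisfies_until; right; split=> //.
        by apply/i1/s1/HY; rewrite setU11.
  pose Z0 : T := (finset.set0, None).
  exists {set T}, [set Z0]%SET,
    (fun (X : {set T}) A => \bigcup_(Z in X) step A Z)%SET,
    (fun (X : {set T}) w => exists2 Z, Z \in X & holds Z w).
  split=> [w|X w].
    split=> [[Z]|w_sat]; first by rewrite inE => /eqP -> [].
    by exists Z0; rewrite ?inE//; split=> //= y; rewrite inE.
  split=> [[Z ZX /stepP[Z' ZZ' Z'w]]|[Z' /bigcupP[Z ZX ZZ'] Z'w]].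
    by exists Z' => //; apply/bigcupP; exists Z.
  by exists Z => //; apply/stepP; exists Z'.
Qed.

(** Accepting states are those whose residual language contains every word. This is kept by every
    letter, and [satisfies_prefix] provides a prefix that leads to such a state. *)
Lemma scltl_automaton phi :
  exists (Q : finType) (q0 : Q) (delta : Q -> {set AP} -> Q) (F : pred Q),
    (forall q A, F q -> F (delta q A)) /\
    (forall w, satisfies w phi <-> exists n, F (foldl delta q0 (mkseq w n))).
Proof.
have [Q [q0 [delta [L [L0 Ldelta]]]]] := scltl_residuals phi.
have Lfold n q w :
    L q w <-> L (foldl delta q (mkseq w n)) (fun i => w (n + i)%N).
  elim: n q w => [|n IH] q w //; rewrite Ldelta (IH _ (fun i => w i.+1)).
  rewrite /mkseq /= -[1%N]/(1 + 0)%N iotaDl -map_comp.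
  by under [X in _ <-> L _ X]eq_fun => i do rewrite addSn.
exists Q, q0, delta, (fun q => `[< forall w, L q w >]); split=> [q A|w].
  move=> /asboolP Lq; apply/asboolP => w.
  by have /Ldelta := Lq (fun i => if i is j.+1 then w j else A).
split=> [/satisfies_prefix[n nP]|[n /asboolP nL]]; last first.
  by apply/L0/(Lfold n).
exists n; apply/asboolP => w'.
(* The splice of the good prefix of [w] with an arbitrary continuation [w']. *)
pose v i := if (i < n)%N then w i else w' (i - n)%N.
have /L0/(Lfold n) : satisfies v phi by apply: nP => i ni; rewrite /v ni.
have -> : mkseq v n = mkseq w n.
  by apply/eq_in_map => i; rewrite mem_iota /v => /andP[_ ->].
congr (L _ _); apply/funext => i.
by rewrite /v ltnNge leq_addr /= addKn.
Qed.

End CoSafety.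

(** * Averages over distributions and decision rules; deterministic rules *)

Section DecisionRules.
Context (R : realType) (M : mdp R).
Notation S := (state M).
Notation A := (action M).

Definition distribution (mu : S -> R) :=
  (forall s, 0 <= mu s) /\ \sum_s mu s = 1.

Lemma distribution_start s : distribution (@start R M s).
Proof.
split=> [s'|]; first exact: ler0n.
by rewrite (bigD1 s)//= big1 ?addr0 /start ?eqxx// => s' /negPf ->.
Qed.

Lemma distribution_trans s a : a \in avail s -> distribution (@trans R M s a).
Proof. by move=> sa; split=> [s'|]; [exact: trans_ge0|exact: trans_sum]. Qed.

Lemma ler_mean (mu : S -> R) (f g : S -> R) : distribution mu ->
  (forall s, f s <= g s) -> \sum_s mu s * f s <= \sum_s mu s * g s.
Proof.
by move=> [mu0 _] fg; apply: ler_sum => s _; rewrite ler_wpM2l.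
Qed.

Lemma mean_cst (mu : S -> R) c : distribution mu -> \sum_s mu s * c = c.
Proof. by move=> [_ mu1]; rewrite -mulr_suml mu1 mul1r. Qed.

Lemma start_mean s (f : S -> R) : \sum_s' @start R M s s' * f s' = f s.
Proof.
rewrite (bigD1 s)//= big1 ?addr0 /start ?eqxx ?mul1r// => s' /negPf ->.
by rewrite mul0r.
Qed.

Lemma ler_rule (d : decision_rule M) s (f g : A -> R) :
  (forall a, a \in avail s -> f a <= g a) ->
  \sum_a d s a * f a <= \sum_a d s a * g a.
Proof.
move=> fg; apply: ler_sum => a _; have [sa|sa] := boolP (a \in avail s).
  by rewrite ler_wpM2l ?rule_ge0// fg.
by rewrite rule_avail// !mul0r.
Qed.

Lemma rule_cst (d : decision_rule M) s c : \sum_a d s a * c = c.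
Proof. by rewrite -mulr_suml rule_sum mul1r. Qed.

Lemma decision_rule_eq (d d' : decision_rule M) :
  (forall s a, d s a = d' s a) -> d = d'.
Proof.
case: d d' => [r r0 r1 ra] [r' r'0 r'1 r'a] /= rr'.
have {}rr' : r = r' by apply/funext => s; apply/funext => a.
by subst r'; congr DecisionRule; exact: Prop_irrelevance.
Qed.

(** The fallback to an available action turns every [f] into a legal rule, so policies can be
    indexed by a full finite function type. *)
Definition choice_at (f : S -> A) s : A :=
  if f s \in avail s then f s else xchoose (avail_ex s).

Lemma choice_at_avail f s : choice_at f s \in avail s.
Proof. by rewrite /choice_at; case: ifP => // _; exact: xchooseP. Qed.

Lemma det_rule_ge0 f s a : 0 <= (a == choice_at f s)%:R :> R.
Proof. exact: ler0n. Qed.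

Lemma det_rule_mean f s (g : A -> R) :
  \sum_a (a == choice_at f s)%:R * g a = g (choice_at f s).
Proof.
rewrite (bigD1 (choice_at f s))//= eqxx mul1r big1 ?addr0// => a /negPf ->.
by rewrite mul0r.
Qed.

Lemma det_rule_sum f s : \sum_a (a == choice_at f s)%:R = 1 :> R.
Proof.
rewrite -[RHS](det_rule_mean f s (fun=> 1)).
by apply: eq_bigr => a _; rewrite mulr1.
Qed.

Lemma det_rule_avail f s a :
  a \notin avail s -> (a == choice_at f s)%:R = 0 :> R.
Proof.
by move=> sa; case: eqP => // E; rewrite E choice_at_avail in sa.
Qed.

Definition det_rule (f : S -> A) : decision_rule M :=
  DecisionRule (det_rule_ge0 f) (det_rule_sum f) (@det_rule_avail f).

End DecisionRules.

(** * Finite-memory policies against arbitrary ones for bounded-horizon reachability *)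

Section Reachability.
Context (R : realType) (M : mdp R) (Q : finType).
Notation S := (state M).
Notation A := (action M).
Context (delta : Q -> S -> Q) (F : pred Q)
  (F_absorbing : forall q s, F q -> F (delta q s)).

(** [q] is the automaton state before the next state, drawn from [mu], is read. As [F] is absorbing,
    testing it after [n] letters detects every earlier visit. *)
Fixpoint reach (n : nat) (mu : S -> R) (pi : policy M) (q : Q) : R :=
  if n is m.+1 then
    \sum_s mu s * \sum_a pi [::] s a *
      reach m (trans s a) (fun h => pi ((s, a) :: h)) (delta q s)
  else (F q)%:R.

Lemma reach_ge0 n mu pi q : distribution mu -> 0 <= reach n mu pi q.
Proof.
elim: n mu pi q => [|n IH] mu pi q dmu /=; first exact: ler0n.
apply: sumr_ge0 => s _; rewrite mulr_ge0 ?(proj1 dmu)//.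
apply: sumr_ge0 => a _; have [sa|sa] := boolP (a \in avail s).
  by rewrite mulr_ge0 ?rule_ge0// IH//; exact: distribution_trans.
by rewrite rule_avail// mul0r.
Qed.

Lemma reach_final n mu pi q : distribution mu -> F q -> reach n mu pi q = 1.
Proof.
elim: n mu pi q => [|n IH] mu pi q dmu Fq /=; first by rewrite Fq.
rewrite -[RHS](mean_cst _ dmu); apply: eq_bigr => s _; congr (_ * _).
rewrite -[RHS](rule_cst (pi [::]) s); apply: eq_bigr => a _.
have [sa|sa] := boolP (a \in avail s); last by rewrite rule_avail// !mul0r.
by rewrite IH ?F_absorbing//; exact: distribution_trans.
Qed.

(** The memory lags by one letter: the automaton has read the past states only, and the current
    state enters as the first component. *)
Definition memory_policy (f : {ffun S * Q -> A}) (q : Q) : policy M :=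
  fun h => det_rule (fun s => f (s, foldl delta q (unzip1 h))).

Lemma reach_memory n mu f q :
  reach n.+1 mu (memory_policy f q) q =
  \sum_s mu s * let a := choice_at (fun s => f (s, q)) s in
    reach n (trans s a) (memory_policy f (delta q s)) (delta q s).
Proof. by apply: eq_bigr => s _; rewrite det_rule_mean. Qed.

Definition backup (v : S -> Q -> R) s q a :=
  \sum_s' trans s a s' * v s' (delta q s).

Definition greedy (v : S -> Q -> R) s q : A :=
  [arg max_(a > xchoose (avail_ex s) | a \in avail s) backup v s q a]%O.

Lemma greedyP v s q : greedy v s q \in avail s /\
  forall a, a \in avail s -> backup v s q a <= backup v s q (greedy v s q).
Proof. by rewrite /greedy; case: arg_maxP => //; exact: xchooseP. Qed.

Section Discount.
Context (l : R) (l_ge0 : 0 <= l) (l_le1 : l <= 1).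

(** Bellman iterates for reaching [F], with a factor [l] for each stage spent outside [F]. *)
Fixpoint value n s q : R :=
  if n is m.+1 then
    if F q then 1 else l * backup (value m) s q (greedy (value m) s q)
  else (F q)%:R.

Lemma value_ge0 n s q : 0 <= value n s q.
Proof.
elim: n s q => [|n IH] s q /=; first exact: ler0n.
case: ifP => // _; have [sa _] := greedyP (value n) s q.
by rewrite mulr_ge0// sumr_ge0// => s' _; rewrite mulr_ge0// trans_ge0.
Qed.

Lemma value_le1 n s q : value n s q <= 1.
Proof.
elim: n s q => [|n IH] s q /=; first by rewrite lern1 leq_b1.
case: ifP => // _; have [sa _] := greedyP (value n) s q.
rewrite -[leRHS]mul1r ler_pM ?sumr_ge0// => [s' _|].
  by rewrite mulr_ge0 ?value_ge0// trans_ge0.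
rewrite -[leRHS](mean_cst _ (distribution_trans sa)).
exact: ler_mean (distribution_trans sa) _.
Qed.

Lemma backup_le_value n s q a : a \in avail s ->
  l * backup (value n) s q a <= value n.+1 s q.
Proof.
move=> sa /=; case: ifP => Fq; last by rewrite ler_wpM2l// (greedyP _ s q).2.
rewrite -[leRHS]mul1r ler_pM ?sumr_ge0// => [s' _|].
  by rewrite mulr_ge0 ?value_ge0// trans_ge0.
rewrite -[leRHS](mean_cst _ (distribution_trans sa)).
by apply: ler_mean (distribution_trans sa) _ => s'; exact: value_le1.
Qed.

Lemma value_leS n s q : value n s q <= value n.+1 s q.
Proof.
elim: n s q => [|n IH] s q.
  rewrite /=; case: ifP => // _; have [sa _] := greedyP (value 0) s q.
  by rewrite mulr_ge0// sumr_ge0// => s' _; rewrite mulr_ge0// trans_ge0.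
have [sa _] := greedyP (value n) s q.
case: (boolP (F q)) => [Fq|/negPf nFq]; first by rewrite /= Fq.
apply: le_trans (backup_le_value n.+1 q sa); rewrite [leLHS]/= nFq ler_wpM2l//.
exact: ler_mean (distribution_trans sa) _.
Qed.

(** A run reaching [F] within [n] stages collects at most [n] factors [l], so the discounted optimum
    keeps at least [l ^+ n] of its probability. *)
Lemma reach_le_value n mu pi q : distribution mu ->
  l ^+ n * reach n mu pi q <= \sum_s mu s * value n s q.
Proof.
elim: n mu pi q => [|n IH] mu pi q dmu.
  by rewrite expr0 mul1r /= mean_cst.
rewrite mulr_sumr; apply: ler_sum => s _.
rewrite mulrCA ler_wpM2l ?(proj1 dmu)// mulr_sumr.
rewrite -[leRHS](rule_cst (pi [::]) s).
under eq_bigr => a _ do rewrite mulrCA.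
apply: ler_rule => a sa; apply: le_trans (backup_le_value n q sa).
by rewrite exprS -mulrA ler_wpM2l// IH//; exact: distribution_trans.
Qed.

(* The greedy policy of the discounted problem is judged by its undiscounted
   reachability probability: iterating [value n <= value n.+1] along this
   policy [m] times leaves an error of at most [l ^+ m]. *)
Lemma value_le_reach n m mu q : distribution mu ->
  \sum_s mu s * value n s q <=
  reach m mu (memory_policy [ffun x => greedy (value n) x.1 x.2] q) q + l ^+ m.
Proof.
set f := [ffun x => _].
have fE s q' : choice_at (fun s => f (s, q')) s = greedy (value n) s q'.
  by rewrite /choice_at ffunE (greedyP _ s q').1.
elim: m mu q => [|m IH] mu q dmu.
  rewrite expr0 -[leLHS]add0r lerD ?ler0n// -[leRHS](mean_cst _ dmu).
  by apply: ler_mean => // s; exact: value_le1.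
have [Fq|nFq] := boolP (F q).
  rewrite reach_final// -[leLHS]addr0 lerD ?exprn_ge0//.
  rewrite -[leRHS](mean_cst _ dmu).
  by apply: ler_mean => // s; exact: value_le1.
rewrite reach_memory -[X in _ + X](mean_cst _ dmu) -big_split /=.
under [leRHS]eq_bigr => s _ do rewrite -mulrDr.
apply: ler_mean => // s; rewrite fE; set a := greedy _ _ _.
have sa : a \in avail s := (greedyP _ s q).1.
have dsa := distribution_trans sa.
apply: le_trans (value_leS _ _ _) _; rewrite /= (negPf nFq).
rewrite exprS; apply: (@le_trans _ _ (l * (reach m (trans s a)
  (memory_policy f (delta q s)) (delta q s) + l ^+ m))).
  by rewrite ler_wpM2l// IH.
by rewrite mulrDr lerD// ler_piMl// reach_ge0.
Qed.

End Discount.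

(** The greedy policy varies with [l], but [b] bounds all memory policies at once and so survives
    both limits: first [m] to infinity, which removes the error [l ^+ m], then [l] to 1 from the
    left. *)
Lemma reach_le_memory n mu pi q b : distribution mu ->
  (forall f m, reach m mu (memory_policy f q) q <= b) ->
  reach n mu pi q <= b.
Proof.
move=> dmu fb; set r := reach n mu pi q.
have rb l : 0 <= l < 1 -> l ^+ n * r <= b.
  move=> /andP[l0 l1].
  apply: le_trans (reach_le_value l0 (ltW l1) n pi q dmu) _.
  apply/ler_addgt0Pr => e e0.
  have : l ^+ m @[m --> \oo] --> 0 by apply: cvg_expr; rewrite ger0_norm.
  move=> /cvgrPdist_lt/(_ _ e0)[m _ /(_ m (leqnn m))].
  rewrite /= sub0r normrN ger0_norm ?exprn_ge0// => /ltW lme.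
  apply: le_trans (value_le_reach l0 (ltW l1) n m q dmu) _.
  by rewrite lerD.
have : x ^+ n * r @[x --> (1 : R)^'-] --> r.
  rewrite -[X in _ --> X]mul1r; apply: cvgMl; apply: cvg_at_left_filter.
  by rewrite -[X in _ --> X](expr1n R n); exact: exprn_continuous.
move=> cvr; rewrite -(cvg_lim _ cvr)//; apply: limr_le; first exact: cvgP cvr.
near=> y; apply: rb; apply/andP; split; near: y.
  exact: nbhs_left_ge.
exact: nbhs_left_lt.
Unshelve. all: by end_near. Qed.

End Reachability.

(** * Sums over the extensions of a word *)

Section ExtensionSums.
Context (R : realType) (T : finType).
Implicit Types (f g : seq T -> R) (w : seq T).

(** The common form of [mass], which extends words at the end, and [reach], which recurses from the
    front of the run. *)
Fixpoint ext_sum f n w : R :=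
  if n is m.+1 then \sum_x ext_sum f m (rcons w x) else f w.

Lemma eq_ext_sum f g n w :
  (forall w', size w' = (size w + n)%N -> f w' = g w') ->
  ext_sum f n w = ext_sum g n w.
Proof.
elim: n w => [|n IH] w fg /=; first by apply: fg; rewrite addn0.
by apply: eq_bigr => x _; apply: IH => w'; rewrite size_rcons addSnnS => /fg.
Qed.

Lemma ext_sum_cons f n x w :
  ext_sum f n (x :: w) = ext_sum (fun w => f (x :: w)) n w.
Proof. by elim: n w => [//|n IH] w /=; apply: eq_bigr => y _; exact: IH. Qed.

Lemma ext_sumZ c f n w : ext_sum (fun w => c * f w) n w = c * ext_sum f n w.
Proof.
elim: n w => [//|n IH] w /=; rewrite mulr_sumr.
by apply: eq_bigr => y _; exact: IH.
Qed.

Lemma massE (x0 : T) (p : cyl_weights R T) n w (A : set (infseq x0)) :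
  mass p n w A =
  ext_sum (fun w => if `[< A (nth x0 w) >] then p w else 0) n w.
Proof. by elim: n w => [//|n IH] w /=; apply: eq_bigr => x _; exact: IH. Qed.

End ExtensionSums.

(** * The satisfaction probability as a limit of reachability probabilities *)

Section SatisfactionProbability.
Context (R : realType) (M : mdp R) (Q : finType).
Notation S := (state M).
Notation A := (action M).
Context (delta : Q -> S -> Q) (F : pred Q) (q0 : Q)
  (F_absorbing : forall q s, F q -> F (delta q s)).

Lemma reach_ext_sum n (mu : S -> R) (pi : policy M) q :
  reach delta F n mu pi q =
  ext_sum (fun w => run_prob mu pi w * (F (foldl delta q (unzip1 w)))%:R)
    n [::].
Proof.
elim: n mu pi q => [|n IH] mu pi q /=; first by rewrite mul1r.
under eq_bigr => s _ do rewrite mulr_sumr.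
rewrite pair_bigA; apply: eq_bigr => -[s a] _ /=.
rewrite ext_sum_cons mulrA IH -ext_sumZ; apply: eq_ext_sum => w _ /=.
by rewrite !mulrA.
Qed.

Definition reached n : set (infseq (default_pair M)) :=
  [set u | F (foldl delta q0 (mkseq (fun t => (u t).1) n))].

Lemma determined_reached n : determined n (reached n).
Proof.
move=> u v uv; rewrite /reached /=; congr (is_true (F (foldl _ _ _))).
by apply/eq_in_map => i; rewrite mem_iota => /andP[_ /uv ->].
Qed.

Lemma path_law_reached s pi n :
  path_law s pi (reached n) = (reach delta F n (@start R M s) pi q0)%:E.
Proof.
have dn := @determined_reached n.
rewrite /path_law cyl_measureE; last by exists n.
rewrite (cyl_contentE _ dn) massE reach_ext_sum; congr EFin.
apply: eq_ext_sum => w; rewrite add0n => wn.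
rewrite /reached /=.
have -> : mkseq (fun t => (nth (default_pair M) w t).1) n = unzip1 w.
  by rewrite -wn -[in RHS](mkseq_nth (default_pair M) w) /unzip1 -map_comp.
by rewrite asboolb; case: (F _); rewrite ?mulr1 ?mulr0.
Qed.

Lemma reached_nondecreasing : {homo reached : m n / (m <= n)%N >-> (m <= n)%O}.
Proof.
apply: homo_leq => [D|D C E|n]; [exact: lexx|exact: le_trans|].
apply/subsetPset => u Fu.
by rewrite /reached /mkset mkseqS foldl_rcons F_absorbing.
Qed.

Section Formula.
Context (phi : scltl (ap M)) (phiP : forall u : nat -> S * A,
  path_satisfies phi u <->
  exists n, F (foldl delta q0 (mkseq (fun t => (u t).1) n))).

Lemma sat_setE :
  [set u : infseq (default_pair M) | path_satisfies phi u] =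
  \bigcup_n reached n.
Proof.
by apply/seteqP; split=> u; [move/phiP => [n Fn]; exists n
  |move=> [n _ Fn]; apply/phiP; exists n].
Qed.

Lemma measurable_reached n :
  measurable (reached n : set (g_sigma_algebraType
    (measurable : set (set (infseq (default_pair M)))))).
Proof. by apply: sub_sigma_algebra; exists n; exact: determined_reached. Qed.

(** Continuity of the path law from below along the increasing events [reached n]. *)
Lemma sat_prob_cvg pi :
  ((reach delta F n (@start R M (init M)) pi q0)%:E @[n --> \oo] -->
   sat_prob phi pi)%E.
Proof.
rewrite /sat_prob sat_setE.
under eq_fun => n do rewrite -path_law_reached.
apply: nondecreasing_cvg_mu; first exact: measurable_reached.
  by apply: bigcup_measurable => n _; exact: measurable_reached.
exact: reached_nondecreasing.
Qed.

Lemma reach_le_sat_prob pi n :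
  ((reach delta F n (@start R M (init M)) pi q0)%:E <= sat_prob phi pi)%E.
Proof.
rewrite -path_law_reached; rewrite /sat_prob sat_setE.
apply: le_measure; rewrite ?inE; first exact: measurable_reached.
  by apply: bigcup_measurable => k _; exact: measurable_reached.
exact: bigcup_sup.
Qed.

Lemma sat_prob_le pi b :
  (forall n, reach delta F n (@start R M (init M)) pi q0 <= b) ->
  (sat_prob phi pi <= b%:E)%E.
Proof.
move=> rb; rewrite -(cvg_lim _ (@sat_prob_cvg pi))//.
apply: lime_le; first exact: cvgP (@sat_prob_cvg pi).
by near=> n; rewrite lee_fin.
Unshelve. all: by end_near. Qed.

(** A best [f] exists since there are finitely many; its satisfaction probability bounds [reach] for
    all memory policies, hence for all policies. *)
Lemma memory_policy_optimal : exists f : {ffun S * Q -> A},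
  forall pi, (sat_prob phi pi <= sat_prob phi (memory_policy delta f q0))%E.
Proof.
pose p (f : {ffun S * Q -> A}) := sat_prob phi (memory_policy delta f q0).
pose f0 : {ffun S * Q -> A} := [ffun=> (default_pair M).2].
pose f := [arg max_(f > f0) p f]%O.
have fmax g : (p g <= p f)%E by rewrite /f; case: arg_maxP => // g' _; exact.
have pfin : p f \is a fin_num.
  rewrite /p /sat_prob sat_setE; apply: fin_num_measure.
  by apply: bigcup_measurable => n _; exact: measurable_reached.
exists f => pi; rewrite -/(p f) -(fineK pfin); apply: sat_prob_le => n.
apply: reach_le_memory => // [|g m]; first exact: distribution_start.
rewrite -lee_fin fineK//; apply: le_trans (fmax g); exact: reach_le_sat_prob.
Qed.

End Formula.

End SatisfactionProbability.

(** * Steering an agent with horizon 1 by a bonus *)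

Section MyopicAgent.
Context (R : realType) (M : mdp R).
Notation S := (state M).
Notation A := (action M).

Lemma stage_value1 (g : offers M 1) rho s :
  stage_value g rho s =
  \sum_a rho ord0 s a * (reward s a + (g ord0 s a)%:num).
Proof.
rewrite /stage_value (reindex (fun x : S * A => [tuple x])) /=; last first.
  exists (fun t => thead t) => [x _|t _]; first by [].
  by case/tupleP: t => x t; rewrite (tuple0 t); apply/val_inj.
transitivity (\sum_s' @start R M s s' *
  \sum_a rho ord0 s' a * (reward s' a + (g ord0 s' a)%:num)).
  under [RHS]eq_bigr => s' _ do rewrite mulr_sumr.
  rewrite pair_bigA; apply: eq_bigr => -[s' a] _ /=.
  rewrite mulr1 mulrA big_ord_recl big_ord0 addr0 /= /play /=.
  by case: insubP => // j _ j0; rewrite (ord1 j).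
exact: start_mean.
Qed.

(** The sum dominates each single reward, so its double covers any reward difference; the 1 makes
    the preference strict. *)
Definition bonus : R := 1 + 2 * \sum_(x : S * A) `|reward x.1 x.2|.

Lemma bonus_ge0 : 0 <= bonus.
Proof. by rewrite addr_ge0// mulr_ge0// sumr_ge0. Qed.

Lemma reward_bonus s a b : @reward R M s a + 1 <= reward s b + bonus.
Proof.
have le_sum c : `|reward s c| <= \sum_(x : S * A) `|reward x.1 x.2|.
  by rewrite (bigD1 (s, c))//= lerDl sumr_ge0.
have := le_sum a; have := le_sum b; rewrite !ler_norml /bonus.
by move=> /andP[? ?] /andP[? ?]; lra.
Qed.

Definition force (f : S -> A) : offers M 1 :=
  fun _ s a => NngNum (mulr_ge0 (ler0n R (a == choice_at f s)) bonus_ge0).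

Lemma stage_optimal_force (f : S -> A) rho :
  stage_optimal (force f) rho -> rho ord0 = det_rule f.
Proof.
move=> opt; apply: decision_rule_eq => s a; rewrite /det_rule /=.
set b := choice_at f s; set d := rho ord0.
have := opt (fun=> det_rule f) s; rewrite !stage_value1 det_rule_mean -/b -/d.
rewrite /force /= eqxx mul1r => value_le.
have d0 c : c != b -> d s c = 0.
  (* Each unit of probability moved away from [b] loses at least 1, so the value gap is at least
     this sum, while optimality makes the gap nonpositive. *)
  have : \sum_(c | c != b) d s c <= 0.
    rewrite -(lerD2l (reward s b + bonus)) addr0 addrC -lerBrDl.
    apply: le_trans value_le _.
    rewrite -[X in X - _](rule_cst d s) [X in _ - X]big_mkcond -sumrB.
    apply: ler_sum => c' _; have [->|cb] := eqVneq c' b; rewrite ?eqxx /=.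
      by rewrite mul1r subr0.
    rewrite mul0r addr0 -[X in _ - X]mulr1 -mulrBr ler_wpM2l ?rule_ge0//.
    by rewrite lerBrDr reward_bonus.
  rewrite le_eqVlt ltNge sumr_ge0 ?orbF => [|c' _]; last exact: rule_ge0.
  by move=> /eqP d0 cb; apply: (psumr_eq0P _ d0) => // c' _; exact: rule_ge0.
have [->|ab] := eqVneq a b; last exact: d0.
by rewrite -(rule_sum d s) (bigD1 b)//= big1 ?addr0.
Qed.

End MyopicAgent.

(** * A feasible design, then a near-optimal one *)

Lemma feasible_design_exists (R : realType) (M : mdp R) (phi : scltl (ap M)) :
  exists G : design M 1, feasible phi G.
Proof.
have [Q [q0 [d [F [dF phiP]]]]] := scltl_automaton phi.
pose delta q (s : state M) := d q (label s).
have foldl_delta q l : foldl delta q l = foldl d q (map (@label _ M) l).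
  by elim: l q => [//|s l IH] q /=; rewrite IH.
have [|f fmax] :=
    @memory_policy_optimal R M Q delta F q0 (fun q s => dF q (label s)) phi.
  move=> u; rewrite /path_satisfies phiP.
  by split=> -[n Fn]; exists n; move: Fn; rewrite foldl_delta /mkseq -map_comp.
(* The observed states [p] end with the current one; dropping it gives the automaton the same input
   as in [memory_policy]. *)
exists (fun p => force (fun s =>
  f (s, foldl delta q0 (take (size p).-1 p)))).
move=> pi pi_opt; suff -> : pi = memory_policy delta f q0 by [].
apply/funext => h; apply: decision_rule_eq => s a.
(* With horizon 1 every history ends a period, so the agent's choice is pinned down after each
   [h]. *)
have [|rho rho_opt pi_rho] := pi_opt (size h) h s; first by rewrite muln1.
have := pi_rho ord0 [::] s erefl erefl a; rewrite cats0 => ->.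
rewrite (stage_optimal_force rho_opt) /memory_policy.
by rewrite size_rcons /= -cats1 take_size_cat.
Qed.

Lemma expected_cost_ge0 (R : realType) (M : mdp R) N (G : design M N) pi :
  (0 <= expected_cost G pi)%E.
Proof.
apply: integral_ge0 => u _; apply: nneseries_ge0 => k _ _.
by apply: sume_ge0 => j _; rewrite lee_fin.
Qed.

Theorem proposition2 (R : realType) (M : mdp R) (phi : scltl (ap M)) (eps : R)
    (heps : 0 < eps) :
  exists G : design M 1, eps_optimal phi eps G.
Proof.
have [G0 G0_feasible] := feasible_design_exists phi.
set C := [set cost G' | G' in [set G' : design M 1 | feasible phi G']].
have [infy|infy] := eqVneq (ereal_inf C) +oo%E.
  by exists G0; split=> //; rewrite infy addye// leey.
(* As expected costs are nonnegative, a cost of [-oo] can only be the supremum over an empty set of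
   optimal policies. Such a design is itself a minimizer; otherwise all feasible costs are
   nonnegative and the infimum is finite. *)
have [[G [GF GN]]|costN] :=
    pselect (exists G : design M 1, feasible phi G /\ cost G = -oo%E).
  by exists G; split=> //; rewrite GN leNye.
have inf_fin : ereal_inf C \is a fin_num.
  rewrite fin_numE infy andbT gt_eqF//; apply: (@lt_le_trans _ _ 0%E) => //.
  apply/ereal_infP => _ [G GF <-].
  have [none|/set0P[pi opt]] :=
    eqVneq [set expected_cost G pi | pi in [set pi | agent_optimal G pi]] set0.
    by case: costN; exists G; rewrite /cost none ereal_sup0.
  case: opt => pi' opt _; apply: le_trans (expected_cost_ge0 G pi') _.
  by apply: ereal_sup_ubound; exists pi'.
have [_ [G GF <-] /ltW G_le] := lb_ereal_inf_adherent heps inf_fin.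
by exists G.
Qed.
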